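(* Let $A$ be a proper unital $*$-ring such that $A_\Sigma\cap-A_\Sigma=\{0\}$. Then orthogonality is symmetric on $\mathfrak{c}\cup A_{\mathrm{n}}$: for all $a,b\in\mathfrak{c}\cup A_{\mathrm{n}}$, $ab=0$ if and only if $ba=0$.
   Context: A $*$-ring is an associative ring with a map $a\mapsto a^*$ satisfying $a^{**}=a$, $(ab)^*=b^*a^*$, $(a+b)^*=a^*+b^*$; it is proper if $a^*a=0$ implies $a=0$. Unital means having a two-sided unit $1$. $A_{\mathrm{n}}=\{a\in A:aa^*=a^*a\}$. $A_\Sigma$ is the set of all finite sums $\sum_{k=1}^n a_k^*a_k$ with $n\geq1$, $a_k\in A$. $A_+=\{a\in A:na\in A_\Sigma\text{ for some positive integer }n\}$. $\mathfrak{r}=\{a\in A:a+a^*\in A_+\}$, and $a\preceq b$ means $b-a\in\mathfrak{r}$. $\mathfrak{c}=\{a\in A:a^*a\preceq na\text{ for some positive integer }n\}$. Orthogonality is the relation $a\perp b\Leftrightarrow ab=0$. *)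

(* Defs.v *)
From HB Require Import structures.
From mathcomp Require Import all_boot all_order all_algebra.
From mathcomp Require Import boolp classical_sets.
Set Implicit Arguments.
Unset Strict Implicit.
Unset Printing Implicit Defensive.
Import GRing.Theory.
Local Open Scope classical_set_scope.
Local Open Scope ring_scope.

(* [pzRingType]: associative rings with a two-sided unit, where 1 = 0 is not
   excluded. *)
Record star_ring (A : pzRingType) (star : A -> A) : Prop := StarRing {
  starK : forall a, star (star a) = a;
  starM : forall a b, star (a * b) = star b * star a;
  starD : forall a b, star (a + b) = star a + star b
}.

Definition proper_star (A : pzRingType) (star : A -> A) : Prop :=
  forall a, star a * a = 0 -> a = 0.

Section Cones.
Context (A : pzRingType) (star : A -> A).

Definition normal_elements : set A :=
  [set a | a * star a = star a * a].

(* The number of summands is [n.+1], i.e. at least one. *)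
Definition square_sums : set A :=
  [set x | exists n (a : 'I_n.+1 -> A), x = \sum_(k < n.+1) star (a k) * a k].

Definition positive_elements : set A :=
  [set a | exists2 n : nat, (0 < n)%N & square_sums (a *+ n)].

Definition accretive_elements : set A :=
  [set a | positive_elements (a + star a)].

Definition preceq (a b : A) : Prop := accretive_elements (b - a).

Definition c_elements : set A :=
  [set a | exists2 n : nat, (0 < n)%N & preceq (star a * a) (a *+ n)].

End Cones.

(* Main.v *)
Require Import Defs.
From HB Require Import structures.
From mathcomp Require Import all_boot all_order all_algebra.
From mathcomp Require Import boolp classical_sets.
Set Implicit Arguments.
Unset Strict Implicit.
Unset Printing Implicit Defensive.
Import GRing.Theory.
Local Open Scope classical_set_scope.
Local Open Scope ring_scope.

(** The point is that every [a] which is normal or in [c_elements] has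
    the same right annihilator as its adjoint: [a * b = 0] iff [star a * b = 0]
    ([right_annihilator_star]).  Symmetry follows at once, since

      a b = 0  =>  a^* b = 0  =>  b^* a = 0  =>  b a = 0,

    the outer steps by this property of [a] and of [b], the middle one by
    taking adjoints.

    For normal [a] the property is properness together with
    [(a^* b)^* (a^* b) = b^* a a^* b = b^* a^* a b = (a b)^* (a b)].
    For [a] in [c_elements], a positive multiple of [n (a + a^* ) - 2 a^* a] is
    a sum of squares [S = \sum_k s_k^* s_k].  If [a b = 0] or [a^* b = 0], then
    [b^* (a + a^* ) b = 0], so compressing by [b] leaves, for some [m > 0],
    [\sum_k (s_k b)^* (s_k b) + 2 m (a b)^* (a b) = 0].  Salience and properness
    make every square in a vanishing sum of squares trivial
    ([sum_squares_eq0]), so [a b = 0] and all [s_k b = 0].  Hence [S b = 0],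
    which now reads [n m a^* b = 0]; and [A] is torsion-free, because [n]
    copies of [x^* x] sum to [0] when [n x = 0] ([mulrn_eq0_salient]). *)

Section StarRing.
Context (A : pzRingType) (star : A -> A).
Hypothesis star_ringA : star_ring star.

Lemma star0 : star 0 = 0.
Proof. by apply: (addrI (star 0)); rewrite -(starD star_ringA) !addr0. Qed.

Lemma star_mul_eq0 a b : a * b = 0 -> star b * star a = 0.
Proof. by move=> ab0; rewrite -(starM star_ringA) ab0 star0. Qed.

Lemma square_sums_square x : square_sums star (star x * x).
Proof. by exists 0, (fun=> x); rewrite big_ord1. Qed.

Hypothesis properA : proper_star star.
Hypothesis salient :
  square_sums star `&` (-%R @` square_sums star) = [set 0].

Lemma square_sums_addr_eq0 x y :
  square_sums star x -> square_sums star y -> x + y = 0 -> x = 0.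
Proof.
move=> Sx Sy /eqP; rewrite addr_eq0 => /eqP x_eq.
suff : (square_sums star `&` (-%R @` square_sums star)) x by rewrite salient.
by split=> //; exists y.
Qed.

(** Splitting off the [i]-th square leaves a sum of squares (its [i]-th term
    replaced by [0], which keeps it nonempty), so salience applies. *)
Lemma sum_squares_eq0 n (f : 'I_n -> A) :
  \sum_(k < n) star (f k) * f k = 0 -> forall i, f i = 0.
Proof.
case: n f => [f _ [] // | n f sum0 i]; apply: properA.
apply: (@square_sums_addr_eq0 _ (\sum_(k < n.+1 | k != i) star (f k) * f k)).
- exact: square_sums_square.
- exists n, (fun k => if k == i then 0 else f k).
  rewrite [RHS](bigD1 i) //= eqxx mulr0 add0r.
  by apply: eq_bigr => k /negPf ->.
- by rewrite -[RHS]sum0 [RHS](bigD1 i).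
Qed.

Lemma mulrn_eq0_salient (x : A) n : (0 < n)%N -> x *+ n = 0 -> x = 0.
Proof.
move=> n_gt0 xn0.
apply: (@sum_squares_eq0 n (fun=> x) _ (Ordinal n_gt0)).
by rewrite sumr_const card_ord -mulrnAr xn0 mulr0.
Qed.

Lemma normal_star_mul_eq0 a b :
  normal_elements star a -> (a * b = 0 <-> star a * b = 0).
Proof.
move=> /= a_normal; split=> h; apply: properA.
- by rewrite (starM star_ringA) (starK star_ringA) -mulrA (mulrA a) a_normal
    -(mulrA (star a)) h !mulr0.
- by rewrite (starM star_ringA) -mulrA (mulrA (star a)) -a_normal
    -(mulrA a) h !mulr0.
Qed.

(** The factor [2] appears because [star a * a] is selfadjoint, so it is
    counted twice in the real part of [a *+ n - star a * a]. *)
Lemma c_elementsP a : c_elements star a ->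
  exists n m l (s : 'I_l -> A), [/\ (0 < n)%N, (0 < m)%N &
    \sum_(k < l) star (s k) * s k + (star a * a) *+ (2 * m) =
      (a + star a) *+ (n * m)].
Proof.
case=> n n_gt0 [m m_gt0 [l [s eq_s]]].
exists n, m, l.+1, s; split=> //; rewrite -eq_s.
have starB x y : star (x - y) = star x - star y.
  by apply: (addIr (star y)); rewrite -(starD star_ringA) !subrK.
have starMn x k : star (x *+ k) = star x *+ k.
  elim: k => [|k IHk]; first by rewrite !mulr0n star0.
  by rewrite !mulrS (starD star_ringA) IHk.
rewrite starB starMn (starM star_ringA) (starK star_ringA) addrACA -mulrnDl.
by rewrite -opprD -mulr2n mulrnBl -!mulrnA subrK.
Qed.

(** Either alternative annihilates [star b * (a + star a) * b], which is all
    that the compression by [b] sees of the linear part of [c_elementsP];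
    this is why one argument serves both implications. *)
Lemma c_mul_eq0 a b : c_elements star a ->
  a * b = 0 \/ star a * b = 0 -> a * b = 0 /\ star a * b = 0.
Proof.
move=> /c_elementsP[n [m [l [s [n_gt0 m_gt0 eq_s]]]]] ab0.
have lin0 : star b * (a + star a) * b = 0.
  case: ab0 => h; have := star_mul_eq0 h; rewrite ?(starK star_ringA) => h';
    by rewrite mulrDr mulrDl h' -mulrA h mulr0 mul0r addr0.
have sumE : star b * (\sum_(k < l) star (s k) * s k) * b =
    \sum_(k < l) star (s k * b) * (s k * b).
  rewrite mulr_sumr mulr_suml; apply: eq_bigr => k _.
  by rewrite (starM star_ringA) !mulrA.
have tot0 : \sum_(k < l) star (s k * b) * (s k * b)
    + (star (a * b) * (a * b)) *+ (2 * m) = 0.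
  have := congr1 (fun x => star b * x * b) eq_s.
  rewrite /= mulrDr mulrDl sumE !mulrnAr !mulrnAl lin0 mul0rn.
  by rewrite (starM star_ringA) !mulrA.
have ab_eq0 : a * b = 0.
  (* The [2 * m] copies of [a * b] and the [s k * b] form one vanishing family. *)
  pose f (k : 'I_(l + 2 * m)) := if split k is inl j then s j * b else a * b.
  have f0 : forall i, f i = 0.
    apply: sum_squares_eq0; rewrite big_split_ord /= -[RHS]tot0; congr (_ + _).
      by apply: eq_bigr => k _; rewrite /f (unsplitK (inl k)).
    rewrite -[in RHS](card_ord (2 * m)) -sumr_const.
    by apply: eq_bigr => k _; rewrite /f (unsplitK (inr k)).
  have m2_gt0 : (0 < 2 * m)%N by rewrite muln_gt0.
  have := f0 (rshift l (Ordinal m2_gt0)).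
  by rewrite /f (unsplitK (inr (Ordinal m2_gt0))).
split=> //; move: tot0; rewrite ab_eq0 mulr0 mul0rn addr0 => sum0.
have sb0 := sum_squares_eq0 sum0.
apply: (@mulrn_eq0_salient _ (n * m)); first by rewrite muln_gt0 n_gt0.
have := congr1 (fun x => x * b) eq_s.
rewrite /= mulrDl mulr_suml big1 => [|k _]; last by rewrite -mulrA sb0 mulr0.
by rewrite !mulrnAl -mulrA mulrDl ab_eq0 mulr0 mul0rn !add0r => <-.
Qed.

Lemma right_annihilator_star a b :
  (c_elements star `|` normal_elements star) a ->
  (a * b = 0 <-> star a * b = 0).
Proof.
case=> [a_c | /normal_star_mul_eq0 //].
by split=> h; have [] := @c_mul_eq0 a b a_c; auto.
Qed.

Lemma mul_eq0_swap a b :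
  (c_elements star `|` normal_elements star) a ->
  (c_elements star `|` normal_elements star) b ->
  a * b = 0 -> b * a = 0.
Proof.
move=> a_in b_in /(right_annihilator_star b a_in)/star_mul_eq0.
by rewrite (starK star_ringA) => /(right_annihilator_star a b_in).
Qed.

End StarRing.

Theorem corollary1 (A : pzRingType) (star : A -> A)
    (star_ringA : star_ring star) (properA : proper_star star)
    (salient : square_sums star `&` (-%R @` square_sums star) = [set 0])
    (a b : A)
    (a_in : (c_elements star `|` normal_elements star) a)
    (b_in : (c_elements star `|` normal_elements star) b) :
  a * b = 0 <-> b * a = 0.
Proof. by split; apply: (mul_eq0_swap star_ringA properA salient). Qed.
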